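(* Let $(X,d)$ be a complete semimetric space which admits an upper semicontinuous triangle function $\Phi\colon\mathbb{R}_+^2\to\mathbb{R}_+$ for $d$, let $\varphi:\mathbb{R}_+\to\mathbb{R}_+$ be an upper semicontinuous comparison function, and let $T_1,\ldots,T_n\colon X\to X$ be $\varphi$-contractions. Then there exists a unique fractal in $\mathscr{K}(X)$ with respect to the system $(T_1,\ldots,T_n)$, i.e., there is exactly one $F\in\mathscr{K}(X)$ such that $F=\bigcup_{k=1}^n T_k(F)$.
   Context: $\mathbb{R}_+=[0,\infty)$. A semimetric space $(X,d)$ is a nonempty set $X$ with a symmetric function $d:X\times X\to\mathbb{R}_+$ such that $d(x,y)=0$ if and only if $x=y$ (no triangle inequality is assumed). A triangle function for $d$ is a symmetric function $\Phi:\mathbb{R}_+^2\to[0,\infty]$, monotone increasing (in the weak sense) in both arguments, with $\Phi(0,0)=0$ and $d(x,y)\le\Phi(d(x,z),d(z,y))$ for all $x,y,z\in X$; here $\Phi$ is assumed to be finite-valued. A sequence $(x_n)$ converges to $x$ if $d(x_n,x)\to0$; it is Cauchy if for every $\varepsilon>0$ there is $n_0$ with $d(x_n,x_m)<\varepsilon$ for $n,m\ge n_0$; the space is complete if every Cauchy sequence converges. The ball is $\mathscr{B}(p,r)=\{x\in X: d(x,p)<r\}$. A set $A\subseteq X$ is open if for every $p\in A$ there is $r>0$ with $\mathscr{B}(p,r)\subseteq A$; the open sets form a topology on $X$ (balls need not be open). A set is compact if each of its covers by open sets has a finite subcover; $\mathscr{K}(X)$ is the family of all nonempty compact subsets of $X$.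 A comparison function is a map $\varphi:\mathbb{R}_+\to\mathbb{R}_+$ that is increasing ($s\le t$ implies $\varphi(s)\le\varphi(t)$) and satisfies $\lim_{m\to\infty}\varphi^m(t)=0$ for all $t>0$, where $\varphi^m$ is the $m$-th iterate. A map $T:X\to X$ is a $\varphi$-contraction if $d(T(x),T(y))\le\varphi(d(x,y))$ for all $x,y\in X$. A fractal with respect to $(T_1,\dots,T_n)$ is a nonempty set $F\subseteq X$ with $F=\bigcup_{k=1}^nT_k(F)$. *)

(* Defs.v *)
From HB Require Import structures.
From mathcomp Require Import all_boot all_order all_algebra.
From mathcomp Require Import all_classical all_reals all_analysis.

Set Implicit Arguments.
Unset Strict Implicit.
Unset Printing Implicit Defensive.

Import Order.TTheory GRing.Theory Num.Theory.
Import numFieldNormedType.Exports.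

Local Open Scope classical_set_scope.
Local Open Scope ring_scope.

Definition dist_ball (R : realType) (X : Type) (d : X -> X -> R) (p : X) (r : R)
  : set X := [set x | d x p < r].

(* The topology of a semimetric space is not a separate datum: [open_sdist]
   forces it to be the one generated by the distance (balls need not be open,
   and need not be neighbourhoods of their centers). The factory
   [isSemimetric] below builds the structure from the distance alone. *)
HB.mixin Record Topological_isSemimetric (R : realType) X & Topological X := {
  sdist : X -> X -> R ;
  sdist_ge0 : forall x y, 0 <= sdist x y ;
  sdistC : forall x y, sdist x y = sdist y x ;
  sdist_eq0 : forall x y, sdist x y = 0 <-> x = y ;
  semimetric_nonempty : [set: X] !=set0 ;
  open_sdist : forall A : set X, open A <->
    (forall p, A p -> exists2 r : R, 0 < r & dist_ball sdist p r `<=` A)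
}.

#[short(type="semimetricType")]
HB.structure Definition Semimetric (R : realType) :=
  { X of Topological X & Topological_isSemimetric R X }.

Arguments sdist {R X} : rename.

HB.factory Record isSemimetric (R : realType) X & Choice X := {
  sdist : X -> X -> R ;
  sdist_ge0 : forall x y, 0 <= sdist x y ;
  sdistC : forall x y, sdist x y = sdist y x ;
  sdist_eq0 : forall x y, sdist x y = 0 <-> x = y ;
  semimetric_nonempty : [set: X] !=set0
}.

HB.builders Context R X & isSemimetric R X.

Let op : set_system X := [set A : set X |
  forall p, A p -> exists2 r : R, 0 < r & dist_ball sdist p r `<=` A].

Let opT : op setT.
Proof. by move=> p _; exists 1. Qed.

Let opI : setI_closed op.
Proof.
move=> A B oA oB p [Ap Bp].
have [r r0 rA] := oA p Ap; have [s s0 sB] := oB p Bp.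
exists (Num.min r s); first by rewrite lt_min r0.
move=> x; rewrite /dist_ball/= lt_min => /andP[xr xs].
by split; [exact: rA|exact: sB].
Qed.

Let op_bigU (I : Type) (f : I -> set X) :
  (forall i, op (f i)) -> op (\bigcup_i f i).
Proof.
move=> of_ p [i _ fip]; have [r r0 rf] := of_ i p fip.
by exists r => // x /rf fix_; exists i.
Qed.

HB.instance Definition _ := isOpenTopological.Build X opT opI op_bigU.

Let open_sdist (A : set X) : open A <->
  (forall p, A p -> exists2 r : R, 0 < r & dist_ball sdist p r `<=` A).
Proof. by []. Qed.

HB.instance Definition _ := Topological_isSemimetric.Build R X
  sdist_ge0 sdistC sdist_eq0 semimetric_nonempty open_sdist.

HB.end.

Section semimetric_sequences.
Context {R : realType} {X : semimetricType R}.

(* Convergence is that of the distances to the limit, which in a general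
   semimetric space may differ from convergence for the topology. *)
Definition sdist_cvg (u : nat -> X) (x : X) : Prop :=
  sdist (u n) x @[n --> \oo] --> (0 : R).

Definition sdist_cauchy (u : nat -> X) : Prop :=
  forall e : R, 0 < e -> exists n0 : nat,
    forall n m : nat, (n0 <= n)%N -> (n0 <= m)%N -> sdist (u n) (u m) < e.

End semimetric_sequences.

Definition semimetric_complete (R : realType) (X : semimetricType R) : Prop :=
  forall u : nat -> X, sdist_cauchy u -> exists x : X, sdist_cvg u x.

(* Functions on [0, +oo[ and on its square are represented by functions on R
   and R * R, constrained only at nonnegative arguments. *)
Definition nneg_set (R : realType) : set R := [set t | 0 <= t].
Arguments nneg_set : clear implicits.

Definition upper_semicontinuous_on (R : realType) (Y : topologicalType)
    (D : set Y) (f : Y -> R) : Prop :=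
  forall y, D y -> forall a : R, f y < a ->
    \forall z \near within D (nbhs y), f z < a.

Record triangle_function (R : realType) (X : semimetricType R)
    (Phi : R -> R -> R) : Prop := TriangleFunction {
  triangle_function_ge0 : forall s t, 0 <= s -> 0 <= t -> 0 <= Phi s t ;
  triangle_function_sym : forall s t, 0 <= s -> 0 <= t -> Phi s t = Phi t s ;
  triangle_function_mono : forall s s' t t',
    0 <= s -> s <= s' -> 0 <= t -> t <= t' -> Phi s t <= Phi s' t' ;
  triangle_function00 : Phi 0 0 = 0 ;
  triangle_functionP : forall x y z : X,
    sdist x y <= Phi (sdist x z) (sdist z y)
}.

Record comparison_function (R : realType) (phi : R -> R) : Prop :=
  ComparisonFunction {
  comparison_function_ge0 : forall t, 0 <= t -> 0 <= phi t ;
  comparison_function_mono : forall s t, 0 <= s -> s <= t -> phi s <= phi t ;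
  comparison_function_iter : forall t, 0 < t ->
    iter m phi t @[m --> \oo] --> (0 : R)
}.

Definition phi_contraction (R : realType) (X : semimetricType R)
    (phi : R -> R) (T : X -> X) : Prop :=
  forall x y, sdist (T x) (T y) <= phi (sdist x y).

Definition nonempty_compacts (X : topologicalType) : set (set X) :=
  [set A | A !=set0 /\ cover_compact A].
Arguments nonempty_compacts : clear implicits.

Definition fractal (X : Type) (n : nat) (T : 'I_n -> X -> X) (F : set X)
  : Prop := F !=set0 /\ F = \bigcup_(k in [set: 'I_n]) (T k @` F).

(* Main.v *)
Require Import Defs.
From HB Require Import structures.
From mathcomp Require Import all_boot all_order all_algebra.
From mathcomp Require Import finmap.
From mathcomp Require Import all_classical all_reals all_analysis.

Set Implicit Arguments.
Unset Strict Implicit.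
Unset Printing Implicit Defensive.

Import Order.TTheory GRing.Theory Num.Theory.
Import numFieldNormedType.Exports.

Local Open Scope classical_set_scope.
Local Open Scope ring_scope.

(* Upper semicontinuity of Phi at (0, 0) makes the sets {d < r} a base of a
   Hausdorff uniformity, so balls are neighbourhoods of their centers, and a
   closed, totally bounded subset of the complete space X is compact.

   Existence: let S(A) be the union of the T_k(A). If every point of S(A) is
   within some r of A, then for each e the iterates S^m(A) eventually lie in
   the e-neighbourhood of one of them. For a single map this gives a fixed
   point x, say of T_1. The finite sets S^m({x}) then increase, their union is
   S-invariant and totally bounded, and its closure is the fractal.

   Uniqueness: if K and F are compact fractals, then K lies in the
   r-neighbourhood of F for some r, hence, applying S^m, in its
   phi^m(r)-neighbourhood for all m; since F is closed, K is included in F. *)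

(** * Comparison functions *)

Section comparison_function.
Context {R : realType} {phi : R -> R}.
Hypothesis phiP : comparison_function phi.

(** If [t <= phi t], monotonicity keeps every iterate at or above [t], against convergence to 0. *)
Lemma comparison_function_lt_id t : 0 < t -> phi t < t.
Proof.
move=> t0; rewrite ltNge; apply/negP => tphi.
have le_iter m : t <= iter m phi t.
  elim: m => //= m IH; apply: le_trans tphi _.
  by apply: (comparison_function_mono phiP) => //; exact: ltW.
have /cvgrPdist_lt/(_ _ t0)[N _ /(_ N (leqnn N))] :=
  comparison_function_iter phiP t0.
by rewrite sub0r normrN ger0_norm ?(le_trans (ltW t0))// ltNge le_iter.
Qed.

Lemma comparison_function_le_id t : 0 <= t -> phi t <= t.
Proof.
rewrite le_eqVlt => /predU1P[<-|/comparison_function_lt_id/ltW//].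
(* At 0 the bound comes from [phi 0 <= phi e < e] for every [e > 0]. *)
apply/ler_addgt0Pr => e e0; rewrite add0r.
apply: le_trans (ltW (comparison_function_lt_id e0)).
by apply: (comparison_function_mono phiP) => //; exact: ltW.
Qed.

Lemma comparison_function_iter_lt t e : 0 < t -> 0 < e ->
  \forall m \near \oo, iter m phi t < e.
Proof.
move=> t0 e0.
have /cvgrPdist_lt/(_ _ e0) := comparison_function_iter phiP t0.
apply: filterS => m; rewrite sub0r normrN => /(le_lt_trans _)-> //.
exact: ler_norm.
Qed.

End comparison_function.

(** * The Hutchinson operator and the one-sided Hausdorff distance *)

Definition hutchinson (X I : Type) (T : I -> X -> X) (A : set X) : set X :=
  \bigcup_(k in setT) (T k @` A).

Lemma hutchinson_subset (X I : Type) (T : I -> X -> X) (A B : set X) :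
  A `<=` B -> hutchinson T A `<=` hutchinson T B.
Proof. by move=> AB; apply: subset_bigcup => k _; exact: image_subset. Qed.

Lemma finite_hutchinson (X : Type) (I : finType) (T : I -> X -> X) (A : set X) :
  finite_set A -> finite_set (hutchinson T A).
Proof. by move=> finA; apply: bigcup_finite => // k _; exact: finite_image. Qed.

(* [compact_cover] for a space that is nonempty but carries no base point. *)
Lemma compact_cover_inhabited (X : topologicalType) (x : X) :
  compact = @cover_compact X.
Proof.
pose pX : ptopologicalType := HB.pack X (isPointed.Build X x).
exact: (@compact_cover pX).
Qed.

Section excess.
Context {R : realType} {X : semimetricType R}.
Implicit Types (A B C : set X) (r s : R).

(* One half of the bound [r] on the Hausdorff distance of [A] and [B]. *)
Definition excess_le r A B :=
  forall a, A a -> exists2 b, B b & sdist a b <= r.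

Lemma sdistxx (x : X) : sdist x x = 0 :> R.
Proof. exact/sdist_eq0. Qed.

Lemma excess_le_weak r s A B : r <= s -> excess_le r A B -> excess_le s A B.
Proof. by move=> rs AB a /AB[b Bb /le_trans]; exists b; auto. Qed.

Lemma subset_excess_le r A B : 0 <= r -> A `<=` B -> excess_le r A B.
Proof. by move=> r0 AB a /AB; exists a; rewrite ?sdistxx. Qed.

Lemma excess_le_hutchinson (I : Type) (T : I -> X -> X) (phi : R -> R) r A B :
  comparison_function phi -> (forall k, phi_contraction phi (T k)) ->
  excess_le r A B -> excess_le (phi r) (hutchinson T A) (hutchinson T B).
Proof.
move=> phiP TP AB _ [k _ [a /AB[b Bb abr] <-]].
exists (T k b); first by exists k => //; exists b.
apply: le_trans (TP k a b) _.
by apply: (comparison_function_mono phiP); rewrite ?sdist_ge0.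
Qed.

Lemma excess_le_iter_hutchinson (I : Type) (T : I -> X -> X) (phi : R -> R)
    r A B m :
  comparison_function phi -> (forall k, phi_contraction phi (T k)) ->
  excess_le r A B ->
  excess_le (iter m phi r) (iter m (hutchinson T) A) (iter m (hutchinson T) B).
Proof. by move=> phiP TP AB; elim: m => //= m; exact: excess_le_hutchinson. Qed.

End excess.

(** * Uniformity, topology and compactness *)

Section triangle_function.
Context {R : realType} {X : semimetricType R} {Phi : R -> R -> R}.
Hypothesis PhiP : triangle_function X Phi.
Hypothesis Phi_usc : upper_semicontinuous_on (nneg_set R `*` nneg_set R)
  (fun p : R * R => Phi p.1 p.2).
Implicit Types (A B C F K : set X) (e r : R).

(* The only consequence of upper semicontinuity that is needed, namely that of
   [Phi] at the origin. *)
Lemma sdist_split e : 0 < e -> exists d, [/\ 0 < d, d <= e &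
  forall x y z : X, sdist x z <= d -> sdist z y <= d -> sdist x y < e].
Proof.
move=> e0.
have /nbhs_ballP[r /= r0 rP] : \forall z \near within
    (nneg_set R `*` nneg_set R) (nbhs (0 : R, 0 : R)), Phi z.1 z.2 < e.
  by apply: Phi_usc; [split; exact: lexx|rewrite /= (triangle_function00 PhiP)].
(* Halving [r] puts [(d, d)] strictly inside the ball of radius [r] around the origin. *)
pose d := Num.min e (r / 2).
have d0 : 0 < d by rewrite lt_min e0/= divr_gt0.
have dr : d < r.
  by rewrite gt_min [X in _ || X]ltr_pdivrMr// ltr_pMr// ltr1n orbT.
exists d; split; rewrite ?ge_min ?lexx// => x y z xz zy.
apply: le_lt_trans (triangle_functionP PhiP x y z) _.
apply: (@le_lt_trans _ _ (Phi d d)).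
  by apply: (triangle_function_mono PhiP); rewrite ?sdist_ge0.
apply: (rP (d, d)); last by split; rewrite /nneg_set/= ltW.
by split; rewrite /= /ball/= sub0r normrN gtr0_norm.
Qed.

Lemma excess_le_split e : 0 < e -> exists d, [/\ 0 < d, d <= e &
  forall A B C, excess_le d A B -> excess_le d B C -> excess_le e A C].
Proof.
move=> /sdist_split[d [d0 de dP]]; exists d; split => // A B C AB BC a.
move=> /AB[b /BC[c Cc bc] ab]; exists c => //; apply: ltW.
exact: (dP a c b).
Qed.

Lemma nbhs_sdistP (x : X) A :
  nbhs x A <-> exists2 r : R, 0 < r & dist_ball sdist x r `<=` A.
Proof.
split.
  rewrite nbhsE => -[B [/open_sdist oB Bx] BA].
  by have [r r0 rB] := oB x Bx; exists r => // y /rB/BA.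
move=> xA; rewrite nbhsE.
(* This set is open: if [d] splits [r], each point of the [d]-ball of [y] has its own [d]-ball
   inside the [r]-ball of [y]. *)
exists [set y : X | exists2 r : R, 0 < r & dist_ball sdist y r `<=` A].
  split => //; apply/open_sdist => y [r r0 yA].
  have [d [d0 _ dP]] := sdist_split r0.
  exists d => // z /ltW zy; exists d => // w /ltW wz; apply: yA.
  exact: dP wz zy.
by move=> y [r r0]; apply; rewrite /dist_ball/= sdistxx.
Qed.

Lemma dist_ball_nbhs (x : X) r : 0 < r -> nbhs x (dist_ball sdist x r).
Proof. by move=> r0; apply/nbhs_sdistP; exists r. Qed.

Lemma closure_excess_le r A : 0 < r -> excess_le r (closure A) A.
Proof.
move=> r0 x /(_ _ (dist_ball_nbhs x r0))[y [Ay /ltW yx]].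
by exists y; rewrite // sdistC.
Qed.

Lemma closure_sdistP A (x : X) :
  closure A x <-> forall r, 0 < r -> excess_le r [set x] A.
Proof.
split=> [Ax r r0 _ ->|Ax B /nbhs_sdistP[r r0 rB]].
  by have [a Aa] := closure_excess_le r0 Ax; exists a.
have [d [d0 dr dP]] := sdist_split r0.
have [a Aa xa] := Ax d d0 x erefl.
exists a; split => //; apply: rB; rewrite /dist_ball/= sdistC.
by apply: dP xa _; rewrite sdistxx ltW.
Qed.

Lemma semimetric_hausdorff : hausdorff_space X.
Proof.
move=> p q pq; apply/(@sdist_eq0 R); apply/eqP.
rewrite eq_le sdist_ge0 andbT; apply/ler_addgt0Pr => e e0; rewrite add0r.
have [d [d0 _ dP]] := sdist_split e0.
have [x [/ltW xp /ltW xq]] :=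
  pq _ _ (dist_ball_nbhs p d0) (dist_ball_nbhs q d0).
by apply/ltW/dP; [rewrite sdistC; exact: xp|].
Qed.

Lemma phi_contraction_continuous (phi : R -> R) (f : X -> X) :
  comparison_function phi -> phi_contraction phi f -> continuous f.
Proof.
move=> phiP fP x A /nbhs_sdistP[r r0 rA]; apply/nbhs_sdistP.
exists r => // y yx; apply: rA; apply: le_lt_trans yx.
apply: le_trans (fP y x) _.
by apply: (comparison_function_le_id phiP); exact: sdist_ge0.
Qed.

(** Near each [x] the distance to [y] is at most [Phi 1 (sdist x y)]; compactness makes these local
    bounds uniform. *)
Lemma compact_excess_bounded K (y : X) :
  compact K -> exists2 r, 0 < r & excess_le r K [set y].
Proof.
move=> /compact_near_coveringP/(_ R (pinfty_nbhs R) (fun r x => sdist x y <= r)).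
move=> /(_ _ _)[].
  move=> x _; near=> z r => /=.
  have zx : sdist z x <= 1 :> R.
    by apply/ltW; near: z; exact: dist_ball_nbhs.
  apply: le_trans (triangle_functionP PhiP z y x) _.
  apply: (@le_trans _ _ (Phi 1 (sdist x y))).
    by apply: (triangle_function_mono PhiP); rewrite ?sdist_ge0.
  by near: r; apply: nbhs_pinfty_ge; exact: num_real.
move=> M [_ MP]; pose r := Num.max (M + 1) 1.
exists r; first by rewrite lt_max ltr01 orbT.
by move=> x Kx; exists y => //; apply: MP => //; rewrite lt_max ltrDl ltr01.
Unshelve. all: by end_near. Qed.

(** An ultrafilter on [K] contains balls of every radius; centers for the radii [1/(m+1)] form a
    Cauchy sequence, and the ultrafilter converges to its limit. *)
Lemma totally_bounded_complete_compact K : semimetric_complete X ->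
  closed K ->
  (forall e, 0 < e -> exists2 A, finite_set A & excess_le e K A) -> compact K.
Proof.
move=> X_complete clK tbK; rewrite compact_ultra => F FU FK.
have ballF e : 0 < e -> exists c : X, F [set x | sdist x c <= e].
  move=> /tbK[A /finite_fsetP[D ->] KD]; apply: contrapT => /forallNP nF.
  (* Otherwise the complements of the finitely many balls covering [K] all belong to [F], yet their
     intersection misses [K]. *)
  have FC : F (\bigcap_(c in [set` D]) ~` [set x | sdist x c <= e]).
    apply: filter_bigI => c _.
    by have [/nF|] := in_ultra_setVsetC [set x | sdist x c <= e] FU.
  have [x [/KD[c Dc xc] /(_ c Dc)]] := filter_ex (filterI FK FC).
  exact.
have inv_gt0 m : 0 < m.+1%:R^-1 :> R by rewrite invr_gt0 ltr0n.
have [c cF] := choice (fun m => ballF _ (inv_gt0 m)).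
have inv_le e : 0 < e -> exists N, forall m, (N <= m)%N -> m.+1%:R^-1 <= e.
  move=> e0; have [N _ NP] := near_infty_natSinv_lt (PosNum e0).
  by exists N => m /NP/ltW.
have [x cx] : exists x : X, sdist_cvg c x.
  apply: X_complete => e e0.
  have [d [d0 de dP]] := sdist_split e0.
  have [N NP] := inv_le d d0.
  exists N => i j /NP id /NP jd.
  have [y [/= yi yj]] := filter_ex (filterI (cF i) (cF j)).
  apply: (dP _ _ y); last exact: le_trans yj jd.
  by rewrite sdistC; exact: le_trans yi id.
have Fx : F --> x.
  move=> B /nbhs_sdistP[r r0 rB].
  have [d [d0 de dP]] := sdist_split r0.
  have [N NP] := inv_le d d0.
  have /cvgrPdist_le/(_ _ d0)[M _ MP] := cx.
  pose m := maxn N M.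
  apply: filterS (cF m) => y /= ym; apply: rB; apply: (dP _ _ (c m)).
    by apply: le_trans ym (NP _ _); rewrite leq_maxl.
  have := MP m (leq_maxr _ _); rewrite sub0r normrN.
  by apply: le_trans; exact: ler_norm.
exists x; split => //; apply: clK => B /Fx FB.
exact: filter_ex (filterI FK FB).
Qed.

(** * Orbits of a set under the Hutchinson operator *)

Section hutchinson_orbit.
Context {I : Type} {T : I -> X -> X} {phi : R -> R}.
Hypothesis phiP : comparison_function phi.
Hypothesis TP : forall k, phi_contraction phi (T k).

Let S := hutchinson T.

(** The iterate [m + p + 1] is within [phi^(m+p)(r)] of the iterate [m + p], which is small for
    large [m]. Each step of the induction on [p] splits [e] again, so [N] depends on [p]. *)
Lemma hutchinson_orbit_chain A p r e : 0 < r -> 0 < e ->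
  excess_le r (S A) A ->
  exists N, forall m j, (N <= m)%N -> (j <= p)%N ->
    excess_le e (iter (m + j) S A) (iter m S A).
Proof.
move=> r0 + rA; elim: p e => [|p IH] e e0.
  exists 0 => m j _; rewrite leqn0 => /eqP ->; rewrite addn0.
  by apply: subset_excess_le => //; exact: ltW.
have [d [d0 de dP]] := excess_le_split e0.
have [N1 N1P] := IH d d0.
have [N2 _ N2P] := comparison_function_iter_lt phiP r0 d0.
exists (maxn N1 N2) => m j; rewrite geq_max => /andP[N1m N2m].
rewrite leq_eqVlt => /predU1P[->|]; last first.
  by rewrite ltnS => jp; apply: excess_le_weak de _; exact: N1P.
apply: dP (N1P m p N1m (leqnn p)).
apply: (@excess_le_weak _ _ (iter (m + p) phi r)).
  by apply/ltW/N2P => /=; rewrite (leq_trans N2m)// leq_addr.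
by rewrite addnS iterSr; exact: excess_le_iter_hutchinson.
Qed.

(* Once [phi^p] shrinks [e] to [d], a step of length [p] preserves the property
   of being within [e] of the [N]-th iterate. *)
Lemma hutchinson_orbit_cauchy A r e : 0 < r -> 0 < e ->
  excess_le r (S A) A ->
  exists N, forall m, (N <= m)%N ->
    excess_le e (iter m S A) (iter N S A).
Proof.
move=> r0 e0 rA.
have [d [d0 de dP]] := excess_le_split e0.
(* Taking [q.+1] makes the step length positive, so that the strong induction on [j] descends. *)
have [q _ /(_ q.+1 (leqnSn q))/= pd] := comparison_function_iter_lt phiP e0 d0.
have [N NP] := hutchinson_orbit_chain q.+1 r0 d0 rA.
exists N => m /subnKC <-; elim/ltn_ind: (m - N)%N => j IH.
have [jq|qj] := leqP j q.+1.
  by apply: excess_le_weak de _; exact: NP.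
apply: dP (NP N q.+1 (leqnn _) (leqnn _)).
(* Applying [S^(q+1)] to the inductive bound brings [S^(N+j)(A)] within [d] of [S^(N+q+1)(A)], which
   is itself within [d] of [S^N(A)]. *)
have -> : (N + j = q.+1 + (N + (j - q.+1)))%N.
  by rewrite addnCA subnKC// ltnW.
rewrite iterD (addnC N q.+1) (iterD q.+1 N).
have /IH Nj : (j - q.+1 < j)%N by rewrite ltn_subrL/= (leq_trans _ qj).
apply: (excess_le_weak (ltW pd)).
exact: (excess_le_iter_hutchinson (m := q.+1) phiP TP Nj).
Qed.

End hutchinson_orbit.

(** * Fixed points and fractals *)

Lemma phi_contraction_fixpoint (phi : R -> R) (f : X -> X) :
  semimetric_complete X -> comparison_function phi -> phi_contraction phi f ->
  exists x, f x = x.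
Proof.
move=> X_complete phiP fP; have [x0 _] := @semimetric_nonempty R X.
(* A one-map family acting on singletons reduces the orbit of [x0] to the case of sets. *)
pose T (_ : unit) := f.
have TP k : phi_contraction phi (T k) by [].
have orbitE m : iter m (hutchinson T) [set x0] = [set iter m f x0].
  elim: m => //= m ->; apply/seteqP; split=> [_ [_ _ [_ -> <-]]//|_ ->].
  by exists tt => //; exists (iter m f x0).
have [r r0 rP] := compact_excess_bounded x0 (@compact_set1 X (f x0)).
have /(hutchinson_orbit_cauchy phiP TP r0)cau :
    excess_le r (hutchinson T [set x0]) [set x0].
  by rewrite [hutchinson _ _](orbitE 1%N).
have [x cx] : exists x : X, sdist_cvg (fun m => iter m f x0) x.
  apply: X_complete => e e0; have [d [d0 de dP]] := sdist_split e0.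
  have [N NP] := cau _ d0.
  have dN m : (N <= m)%N -> sdist (iter m f x0) (iter N f x0) <= d.
    by move=> /NP; rewrite !orbitE => /(_ _ erefl)[_ ->].
  exists N => i j /dN iN /dN jN; apply: dP iN _.
  by rewrite sdistC.
exists x; apply/(@sdist_eq0 R)/eqP; rewrite eq_le sdist_ge0 andbT.
apply/ler_addgt0Pr => e e0; rewrite add0r.
have [d [d0 _ dP]] := sdist_split e0.
have /cvgrPdist_le/(_ _ d0)[N _ NP] := cx.
have dN m : (N <= m)%N -> sdist (iter m f x0) x <= d.
  move=> /NP; rewrite sub0r normrN; apply: le_trans; exact: ler_norm.
(* The point [f^(N+1)(x0)] is within [d] of [x] and, since [phi t <= t], also of [f x]. *)
apply/ltW/(dP _ _ (iter N.+1 f x0)); last exact/dN/leqnSn.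
rewrite sdistC; apply: le_trans (fP _ _) _.
apply: le_trans (dN N (leqnn N)).
by apply: (comparison_function_le_id phiP); exact: sdist_ge0.
Qed.

Lemma compact_fractal_subset (I : Type) (T : I -> X -> X) (phi : R -> R) K F :
  comparison_function phi -> (forall k, phi_contraction phi (T k)) ->
  compact K -> K = hutchinson T K ->
  closed F -> F !=set0 -> F = hutchinson T F -> K `<=` F.
Proof.
move=> phiP TP cK KE clF [y Fy] FE x Kx; apply: clF; apply/closure_sdistP.
move=> e e0 _ ->.
have [r r0 rK] := compact_excess_bounded y cK.
have [m _ /(_ m (leqnn m)) me] := comparison_function_iter_lt phiP r0 e0.
have iterE A : A = hutchinson T A -> iter m (hutchinson T) A = A.
  by move=> AE; elim: m {me} => //= m ->.
have rKF : excess_le r K F by move=> a /rK[_ -> ay]; exists y.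
have := excess_le_iter_hutchinson (m := m) phiP TP rKF.
rewrite !iterE// => /(_ x Kx)[b Fb xb]; exists b => //.
exact: le_trans xb (ltW me).
Qed.

(** The right-hand side is a finite union of compact sets, hence closed, and contains [A]; the
    converse inclusion is continuity of the maps. *)
Lemma closure_hutchinson (I : finType) (T : I -> X -> X) (A : set X) :
  (forall k, continuous (T k)) -> compact (closure A) -> A = hutchinson T A ->
  closure A = hutchinson T (closure A).
Proof.
move=> Tcont cA AE; apply/seteqP; split.
  have clS : closed (hutchinson T (closure A)).
    apply: closed_bigcup => [|k _]; first exact: finite_finset.
    apply: compact_closed.
      exact: semimetric_hausdorff.
    by apply: continuous_compact => //; exact: continuous_subspaceT.
  rewrite ((closure_id _).1 clS); apply: closureS.
  by rewrite {1}AE; apply: hutchinson_subset; exact: subset_closure.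
move=> _ [k _ [x Ax <-]] B /Tcont/Ax[y [Ay By]]; exists (T k y).
by split => //; rewrite AE; exists k => //; exists y.
Qed.

(* Starting from a fixed point of one of the maps makes the orbit increasing, so
   that its union is invariant. *)
Lemma hutchinson_compact_fixpoint (I : finType) (i0 : I) (T : I -> X -> X)
    (phi : R -> R) :
  semimetric_complete X -> comparison_function phi ->
  (forall k, phi_contraction phi (T k)) ->
  exists F, [/\ compact F, F !=set0 & F = hutchinson T F].
Proof.
move=> X_complete phiP TP.
have [x Tx] := phi_contraction_fixpoint X_complete phiP (TP i0).
pose A m := iter m (hutchinson T) [set x].
have A_finite m : finite_set (A m).
  by elim: m => [|m]; [exact: finite_set1|exact: finite_hutchinson].
have A_sub m : A m `<=` A m.+1.
  elim: m => [_ ->|m]; first by exists i0 => //; exists x.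
  exact: hutchinson_subset.
have A_mono m p : (m <= p)%N -> A m `<=` A p.
  move=> /subnKC <-; elim: (p - m)%N => [|j IH]; first by rewrite addn0.
  by rewrite addnS => y /IH; exact: A_sub.
pose G := \bigcup_m A m.
have GE : G = hutchinson T G.
  apply/seteqP; split => [y [m _ /A_sub]|_ [k _ [y [m _ Amy] <-]]].
    by apply: hutchinson_subset => z Amz; exists m.
  by exists m.+1 => //; exists k => //; exists y.
have [r r0 rA] := compact_excess_bounded x (finite_compact (A_finite 1%N)).
have cG : compact (closure G).
  apply: totally_bounded_complete_compact => //; first exact: closed_closure.
  move=> e e0; have [d [d0 de dP]] := excess_le_split e0.
  (* All of [G] is within [d] of [A N]: later iterates by this bound, earlier ones by inclusion.
     Passing to the closure costs another [d]. *)
  have [N NP] := hutchinson_orbit_cauchy phiP TP r0 d0 rA.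
  exists (A N) => //; apply: dP (closure_excess_le d0) _.
  move=> y [m _ Amy]; have [/NP|/ltnW mN] := leqP N m; first exact.
  by apply: subset_excess_le (A_mono _ _ mN) _ Amy; exact: ltW.
exists (closure G); split => //.
  by exists x; apply: subset_closure; exists 0.
apply: closure_hutchinson => // k.
exact: phi_contraction_continuous phiP (TP k).
Qed.

End triangle_function.

Theorem theorem14 (R : realType) (X : semimetricType R)
    (X_complete : semimetric_complete X)
    (Phi : R -> R -> R) (Phi_triangle : triangle_function X Phi)
    (Phi_usc : upper_semicontinuous_on (nneg_set R `*` nneg_set R)
                 (fun p : R * R => Phi p.1 p.2))
    (phi : R -> R) (phi_comparison : comparison_function phi)
    (phi_usc : upper_semicontinuous_on (nneg_set R) phi)
    (n : nat) (n_gt0 : (0 < n)%N) (T : 'I_n -> X -> X)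
    (T_contraction : forall k, phi_contraction phi (T k)) :
  exists! F : set X, nonempty_compacts X F /\ fractal T F.
Proof.
have [F [cF F0 FE]] := hutchinson_compact_fixpoint Phi_triangle Phi_usc
  (Ordinal n_gt0) X_complete phi_comparison T_contraction.
have [x _] := F0; exists F; split.
  by rewrite /nonempty_compacts/= -(compact_cover_inhabited x).
move=> K [[K0]]; rewrite -(compact_cover_inhabited x) => cK [_ KE].
have closedX := compact_closed (semimetric_hausdorff Phi_triangle Phi_usc).
have sub := compact_fractal_subset Phi_triangle Phi_usc phi_comparison
  T_contraction.
by apply/seteqP; split; apply: sub => //; exact: closedX.
Qed.
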